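(* Let $G'\subset G$ be a domain. A scalar function $F\colon G'\to\mathbb R$ is a first integral on $G'$ of the normal linear homogeneous system of partial differential equations $$\partial_{x_j}y=\sum_{s=m+1}^n u_{js}(x)\,\partial_{x_s}y,\qquad j=1,\ldots,m,$$ if and only if $F$ is a first integral on $G'$ of the associated total differential system $$dx_s=-\sum_{j=1}^m u_{js}(x)\,dx_j,\qquad s=m+1,\ldots,n.$$
   Context: A domain is an open arcwise connected set. Here $G\subset\mathbb R^n$ is a domain, $m\le n$, $x=(x_1,\ldots,x_n)$, and the coefficients $u_{js}\colon G\to\mathbb R$ are continuous. In the total differential system, $x_1,\ldots,x_m$ are the independent variables and $x_{m+1},\ldots,x_n$ the dependent ones. A first integral on a domain $G'\subset G$ of a linear homogeneous system $\mathfrak L_j(x)y=0$, $j=1,\ldots,m$ (with $\mathfrak L_j$ first-order linear differential operators with continuous coefficients) is a function $F\in C^1(G')$ with $\mathfrak L_jF(x)=0$ for all $x\in G'$, $j=1,\ldots,m$; for the normal system, $\mathfrak L_j=\partial_{x_j}-\sum_{s=m+1}^n u_{js}(x)\partial_{x_s}$. A first integral on a domain of a total differential system is a $C^1$ function $F$ of the independent and dependent variables whose differential vanishes identically on this domain when the differentials of the dependent variables are replaced by their expressions from the system (so that the coefficient of the differential of each independent variable vanishes). *)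

(* Defs.v *)
From HB Require Import structures.
From mathcomp Require Import all_boot all_order all_algebra.
From mathcomp Require Import all_classical all_reals all_analysis.

Set Implicit Arguments.
Unset Strict Implicit.
Unset Printing Implicit Defensive.

Import Order.TTheory GRing.Theory Num.Theory.
Import numFieldNormedType.Exports.

Local Open Scope classical_set_scope.
Local Open Scope ring_scope.

(* The ambient space R^n with m <= n is 'rV[R]_(m + k), i.e. k = n - m.
   The independent variables x_1, ..., x_m are the coordinates lshift k j with
   j : 'I_m, and the dependent variables x_(m+1), ..., x_n are the coordinates
   rshift m s with s : 'I_k.
   A function on a subset G of R^n is represented by a function on all of R^n.
   Its values outside G are irrelevant: on an open G, derivatives depend only
   on the values in G, and continuity is taken in the subspace topology. *)

Definition arcwise_connected (R : realType) (T : topologicalType)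
    (A : set T) : Prop :=
  forall a b, A a -> A b -> exists gamma : R -> T,
    [/\ {within `[0, 1], continuous gamma}, gamma 0 = a, gamma 1 = b
      & gamma @` `[0, 1] `<=` A].

Definition domain (R : realType) (n : nat) (G : set 'rV[R]_n) : Prop :=
  open G /\ arcwise_connected R G.

Definition partial (R : realType) (n : nat) (i : 'I_n) (F : 'rV[R]_n -> R)
    (x : 'rV[R]_n) : R :=
  'D_(delta_mx 0 i) F x.

Definition C1 (R : realType) (n : nat) (G : set 'rV[R]_n)
    (F : 'rV[R]_n -> R) : Prop :=
  (forall x, G x -> differentiable F x) /\
  (forall i, {within G, continuous (partial i F)}).

Definition pde_first_integral (R : realType) (n m : nat)
    (L : 'I_m -> ('rV[R]_n -> R) -> 'rV[R]_n -> R)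
    (G : set 'rV[R]_n) (F : 'rV[R]_n -> R) : Prop :=
  C1 G F /\ forall x, G x -> forall j, L j F x = 0.

Definition normal_operator (R : realType) (m k : nat)
    (u : 'I_m -> 'I_k -> 'rV[R]_(m + k) -> R)
    (j : 'I_m) (y : 'rV[R]_(m + k) -> R) (x : 'rV[R]_(m + k)) : R :=
  partial (lshift k j) y x - \sum_(s < k) u j s x * partial (rshift m s) y x.

(* Given the differentials dx = (dx_1, ..., dx_m) of the independent variables,
   the vector of all n differentials in which those of the dependent variables
   are replaced by their expressions dx_(m+s) = \sum_j w s j x * dx_j. *)
Definition tds_differentials (R : realType) (m k : nat)
    (w : 'I_k -> 'I_m -> 'rV[R]_(m + k) -> R)
    (x : 'rV[R]_(m + k)) (dx : 'rV[R]_m) : 'rV[R]_(m + k) :=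
  row_mx dx (\row_(s < k) \sum_(j < m) w s j x * dx 0 j).

Definition tds_first_integral (R : realType) (m k : nat)
    (w : 'I_k -> 'I_m -> 'rV[R]_(m + k) -> R)
    (G : set 'rV[R]_(m + k)) (F : 'rV[R]_(m + k) -> R) : Prop :=
  C1 G F /\
  forall x, G x -> forall dx, 'd F x (tds_differentials w x dx) = 0.

(* dx_s = - \sum_j u_js(x) dx_j *)
Definition associated_tds (R : realType) (m k : nat)
    (u : 'I_m -> 'I_k -> 'rV[R]_(m + k) -> R) :
    'I_k -> 'I_m -> 'rV[R]_(m + k) -> R :=
  fun s j x => - u j s x.

(* Main.v *)
(* The identity 'd F x (tds_differentials dx) = \sum_j dx_j * L_j F(x) holds at
   every point x where F is differentiable; as the dx_j are arbitrary, the left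
   side vanishes for all dx iff each L_j F(x) is zero. *)

Require Import Defs.
From mathcomp Require Import all_boot all_order all_algebra.
From mathcomp Require Import all_classical all_reals all_analysis.
Import GRing.Theory numFieldNormedType.Exports.

Local Open Scope classical_set_scope.
Local Open Scope ring_scope.

(** Linearity of ['d F x] on the canonical basis: where [F] is differentiable, its differential at a
    basis vector is the directional derivative that defines [partial]. *)
Lemma diff_sum_partial (R : realType) (n : nat) (F : 'rV[R]_n -> R)
    (x v : 'rV[R]_n) :
  differentiable F x -> 'd F x v = \sum_(i < n) v 0 i * partial i F x.
Proof.
move=> dF; rewrite [in LHS](row_sum_delta v) linear_sum.
by apply: eq_bigr => i _; rewrite linearZ /partial deriveE.
Qed.

Lemma diff_associated_tds (R : realType) (m k : nat)
    (u : 'I_m -> 'I_k -> 'rV[R]_(m + k) -> R) (F : 'rV[R]_(m + k) -> R)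
    (x : 'rV[R]_(m + k)) (dx : 'rV[R]_m) :
  differentiable F x ->
  'd F x (tds_differentials (associated_tds u) x dx) =
  \sum_(j < m) dx 0 j * normal_operator u j F x.
Proof.
move=> dF; rewrite diff_sum_partial // big_split_ord /=.
under [X in _ + X = _]eq_bigr => s _ do rewrite row_mxEr mxE mulr_suml.
(* Exchanging the sums over [s] and [j] puts all contributions containing [dx 0 j] together, so the
   coefficients can be compared for each [j] separately. *)
rewrite exchange_big -big_split /=; apply: eq_bigr => j _.
rewrite row_mxEl /normal_operator mulrBr mulr_sumr -sumrN; congr (_ + _).
by apply: eq_bigr => s _; rewrite /associated_tds mulrAC mulrC mulNr mulrN.
Qed.

Theorem theorem2p6 (R : realType) (m k : nat)
    (G : set 'rV[R]_(m + k)) (hG : domain G)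
    (u : 'I_m -> 'I_k -> 'rV[R]_(m + k) -> R)
    (hu : forall j s, {within G, continuous (u j s)})
    (G' : set 'rV[R]_(m + k)) (hG' : domain G') (sG'G : G' `<=` G)
    (F : 'rV[R]_(m + k) -> R) :
  pde_first_integral (normal_operator u) G' F <->
  tds_first_integral (associated_tds u) G' F.
Proof.
split=> -[[dF cF] H]; split=> // x G'x.
  move=> dx; rewrite diff_associated_tds; last exact: dF.
  by rewrite big1 // => j _; rewrite H // mulr0.
(* The [j]-th basis vector as [dx] isolates the [j]-th operator: all other terms get coefficient
   zero. *)
move=> j; have := H x G'x (delta_mx 0 j).
rewrite diff_associated_tds; last exact: dF.
rewrite (bigD1 j) //= mxE !eqxx mul1r big1 ?addr0 // => i /negPf ij.
by rewrite mxE ij andbF mul0r.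
Qed.
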